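(* For $x\in\mathbb R$ and $u,q\in\mathbb H$, $$\sum_{m=0}^\infty\sum_{n=0}^\infty\frac{x^m}{m!}\,H^Q_{m,n}(q,\overline q)\,\frac{u^n}{n!}=e^{xq}\,e_*^{(\overline q,u)}\,e^{-xu}$$ and $$\sum_{m=0}^\infty\sum_{n=0}^\infty\frac{\overline u^{\,m}}{m!}\,H^Q_{m,n}(q,\overline q)\,\frac{u^n}{n!}=e^{-|u|^2}\left|e_*^{(\overline q,u)}\right|^2.$$
   Context: $\mathbb H$ is the algebra of real quaternions, $\overline q$ the quaternionic conjugate, $|q|^2=q\overline q$, and $e^q=\sum_{n\ge0}q^n/n!$. For $p,q\in\mathbb H$, $e_*^{(p,q)}:=\sum_{n=0}^\infty\frac{p^nq^n}{n!}$. For integers $m,n\ge0$, $$H^Q_{m,n}(q,\overline q)=\sum_{k=0}^{\min(m,n)}(-1)^k k!\binom mk\binom nk q^{m-k}\overline q^{\,n-k}.$$ *)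

(* Defs.v *)
From HB Require Import structures.
From mathcomp Require Import all_boot all_order all_algebra.
From mathcomp Require Import all_classical all_reals all_analysis.
From mathcomp Require Import ring lra.

Set Implicit Arguments.
Unset Strict Implicit.
Unset Printing Implicit Defensive.

Import Order.TTheory GRing.Theory Num.Theory.
Import numFieldNormedType.Exports.

Local Open Scope classical_set_scope.
Local Open Scope ring_scope.

(* [Quaternion a b c d] is a + b i + c j + d k. *)
Record quaternion (R : Type) : Type :=
  Quaternion { qre : R; qim_i : R; qim_j : R; qim_k : R }.

Section QuaternionChoice.
Variable R : Type.

Definition tuple_of_quaternion (q : quaternion R) :=
  let: Quaternion a b c d := q in (a, b, c, d).
Definition quaternion_of_tuple (t : R * R * R * R) :=
  let: (a, b, c, d) := t in Quaternion a b c d.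

Lemma tuple_of_quaternionK : cancel tuple_of_quaternion quaternion_of_tuple.
Proof. by case. Qed.

End QuaternionChoice.

HB.instance Definition _ (R : eqType) := Equality.copy (quaternion R)
  (can_type (@tuple_of_quaternionK R)).
HB.instance Definition _ (R : choiceType) := Choice.copy (quaternion R)
  (can_type (@tuple_of_quaternionK R)).

Section QuaternionAlgebra.
Variable R : comNzRingType.
Local Notation H := (quaternion R).

Definition addq (p q : H) : H :=
  let: Quaternion a1 b1 c1 d1 := p in let: Quaternion a2 b2 c2 d2 := q in
  Quaternion (a1 + a2) (b1 + b2) (c1 + c2) (d1 + d2).

Definition oppq (q : H) : H :=
  let: Quaternion a b c d := q in Quaternion (- a) (- b) (- c) (- d).

(* i^2 = j^2 = k^2 = ijk = -1 *)
Definition mulq (p q : H) : H :=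
  let: Quaternion a1 b1 c1 d1 := p in let: Quaternion a2 b2 c2 d2 := q in
  Quaternion (a1 * a2 - b1 * b2 - c1 * c2 - d1 * d2)
             (a1 * b2 + b1 * a2 + c1 * d2 - d1 * c2)
             (a1 * c2 - b1 * d2 + c1 * a2 + d1 * b2)
             (a1 * d2 + b1 * c2 - c1 * b2 + d1 * a2).

Definition scaleq (x : R) (q : H) : H :=
  let: Quaternion a b c d := q in Quaternion (x * a) (x * b) (x * c) (x * d).

Definition qconj (q : H) : H :=
  let: Quaternion a b c d := q in Quaternion a (- b) (- c) (- d).

Lemma addqA : associative addq.
Proof. by case=> ? ? ? ? [? ? ? ?] [? ? ? ?]; congr Quaternion; ring. Qed.
Lemma addqC : commutative addq.
Proof. by case=> ? ? ? ? [? ? ? ?]; congr Quaternion; ring. Qed.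
Lemma add0q : left_id (Quaternion 0 0 0 0) addq.
Proof. by case=> ? ? ? ?; congr Quaternion; ring. Qed.
Lemma addNq : left_inverse (Quaternion 0 0 0 0) oppq addq.
Proof. by case=> ? ? ? ?; congr Quaternion; ring. Qed.

HB.instance Definition _ :=
  GRing.isZmodule.Build H addqA addqC add0q addNq.

Lemma mulqA : associative mulq.
Proof. by case=> ? ? ? ? [? ? ? ?] [? ? ? ?]; congr Quaternion; ring. Qed.
Lemma mul1q : left_id (Quaternion 1 0 0 0) mulq.
Proof. by case=> ? ? ? ?; congr Quaternion; ring. Qed.
Lemma mulq1 : right_id (Quaternion 1 0 0 0) mulq.
Proof. by case=> ? ? ? ?; congr Quaternion; ring. Qed.
Lemma mulqDl : left_distributive mulq +%R.
Proof. by case=> ? ? ? ? [? ? ? ?] [? ? ? ?]; congr Quaternion; ring. Qed.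
Lemma mulqDr : right_distributive mulq +%R.
Proof. by case=> ? ? ? ? [? ? ? ?] [? ? ? ?]; congr Quaternion; ring. Qed.
Lemma oneq_neq0 : Quaternion 1 0 0 0 != 0 :> H.
Proof. by apply/eqP => -[] /eqP; rewrite oner_eq0. Qed.

HB.instance Definition _ := GRing.Zmodule_isNzRing.Build H
  mulqA mul1q mulq1 mulqDl mulqDr oneq_neq0.

Lemma scaleqA (x y : R) (q : H) : scaleq x (scaleq y q) = scaleq (x * y) q.
Proof. by case: q => ? ? ? ?; congr Quaternion; ring. Qed.
Lemma scale1q : left_id 1 scaleq.
Proof. by case=> ? ? ? ?; congr Quaternion; ring. Qed.
Lemma scaleqDr : right_distributive scaleq +%R.
Proof. by move=> ? [? ? ? ?] [? ? ? ?]; congr Quaternion; ring. Qed.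
Lemma scaleqDl (q : H) : {morph scaleq^~ q : x y / x + y}.
Proof. by case: q => ? ? ? ? x y; congr Quaternion; ring. Qed.

HB.instance Definition _ := GRing.Zmodule_isLmodule.Build R H
  scaleqA scale1q scaleqDr scaleqDl.

Lemma scaleqAl (x : R) (p q : H) : x *: (p * q) = x *: p * q.
Proof. by case: p q => ? ? ? ? [? ? ? ?]; congr Quaternion; ring. Qed.

HB.instance Definition _ := GRing.Lmodule_isLalgebra.Build R H scaleqAl.

Lemma scaleqAr (x : R) (p q : H) : x *: (p * q) = p * (x *: q).
Proof. by case: p q => ? ? ? ? [? ? ? ?]; congr Quaternion; ring. Qed.

HB.instance Definition _ := GRing.Lalgebra_isAlgebra.Build R H scaleqAr.

End QuaternionAlgebra.

Section QuaternionNorm.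
Variable R : rcfType.
Local Notation H := (quaternion R).

Definition qnorm (q : H) : R :=
  let: Quaternion a b c d := q in
  Num.sqrt (a ^+ 2 + b ^+ 2 + c ^+ 2 + d ^+ 2).

Lemma qnormD (p q : H) : qnorm (p + q) <= qnorm p + qnorm q.
Proof.
case: p q => a b c d [a' b' c' d'] /=.
set X := a ^+ 2 + _ + _ + _; set Y := a' ^+ 2 + _ + _ + _.
have X0 : 0 <= X by rewrite !addr_ge0 ?sqr_ge0.
have Y0 : 0 <= Y by rewrite !addr_ge0 ?sqr_ge0.
rewrite -[leRHS]ger0_norm ?addr_ge0 ?sqrtr_ge0// -sqrtr_sqr ler_wsqrtr//.
rewrite [leRHS]sqrrD !sqr_sqrtr// -sqrtrM//.
set S := a * a' + b * b' + c * c' + d * d'.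
have SXY : S <= Num.sqrt (X * Y).
  apply: (le_trans (ler_norm _)); rewrite -sqrtr_sqr ler_wsqrtr// -subr_ge0.
  have -> : X * Y - S ^+ 2 =
      (a * b' - b * a') ^+ 2 + (a * c' - c * a') ^+ 2 + (a * d' - d * a') ^+ 2
    + (b * c' - c * b') ^+ 2 + (b * d' - d * b') ^+ 2 + (c * d' - d * c') ^+ 2.
    by rewrite /X /Y /S; ring.
  by rewrite !addr_ge0 ?sqr_ge0.
rewrite [leLHS](_ : _ = X + S *+ 2 + Y); last by rewrite /X /Y /S; ring.
by rewrite lerD2r lerD2l lerMn2r.
Qed.

Lemma qnormZ (x : R) (q : H) : qnorm (x *: q) = `|x| * qnorm q.
Proof.
case: q => a b c d /=; rewrite -sqrtr_sqr -sqrtrM ?sqr_ge0//.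
by congr Num.sqrt; ring.
Qed.

Lemma qnorm0_eq0 (q : H) : qnorm q = 0 -> q = 0.
Proof.
case: q => a b c d /= /eqP.
rewrite sqrtr_eq0 le_eqVlt ltNge !addr_ge0 ?sqr_ge0//= orbF.
rewrite !paddr_eq0 ?addr_ge0 ?sqr_ge0// !sqrf_eq0.
by move=> /andP[/andP[/andP[/eqP-> /eqP->] /eqP->] /eqP->].
Qed.

(* This installs `|q| = qnorm q together with the induced topology. *)
HB.instance Definition _ :=
  Lmodule_isNormed.Build R H qnormD qnormZ qnorm0_eq0.

Lemma mulq_conj (q : H) : q * qconj q = (`|q| ^+ 2)%:A.
Proof.
case: q => a b c d; rewrite [X in _ = (X ^+ 2)%:A]/Num.norm /=.
rewrite sqr_sqrtr ?addr_ge0 ?sqr_ge0//.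
by congr Quaternion; ring.
Qed.

End QuaternionNorm.

Section QuaternionSeries.
Variable R : realType.
Local Notation H := (quaternion R).

Definition qexp (q : H) : H :=
  limn (series (fun n => n`!%:R^-1 *: q ^+ n)).

Definition qexp_star (p q : H) : H :=
  limn (series (fun n => n`!%:R^-1 *: (p ^+ n * q ^+ n))).

Definition hermiteQ (m n : nat) (q : H) : H :=
  \sum_(k < (minn m n).+1)
    ((-1) ^+ k * k`!%:R * 'C(m, k)%:R * 'C(n, k)%:R)
      *: (q ^+ (m - k) * qconj q ^+ (n - k)).

(* \sum_m \sum_n a m n = l as an iterated series: every inner series converges,
   and the series of the inner sums converges to l. *)
Definition iterated_sum_to (a : nat -> nat -> H) (l : H) : Prop :=
  (forall m, cvgn (series (a m))) /\
  series (fun m => limn (series (a m))) @ \oo --> l.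

End QuaternionSeries.

(* Main.v *)
Require Import Defs.
From mathcomp Require Import all_boot all_order all_algebra.
From mathcomp Require Import all_classical all_reals all_analysis.
From mathcomp Require Import ring lra.

Set Implicit Arguments.
Unset Strict Implicit.
Unset Printing Implicit Defensive.

Import Order.TTheory GRing.Theory Num.Theory.
Import numFieldNormedType.Exports.

Local Open Scope classical_set_scope.
Local Open Scope ring_scope.

(** The statement follows from one identity for a third quaternion p in place
of the left variable.  Substituting m = a + k and n = b + k in the definition
of the Hermite polynomials gives, formally,

  sum_(m, n) p^m/m! H_(m,n)(q, q^bar) u^n/n!
    = sum_k (-1)^k/k! p^k (sum_a p^a q^a/a!) (sum_b q^bar^b u^b/b!) u^k
    = sum_k (-1)^k/k! p^k e_*(p, q) e_*(q^bar, u) u^k.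

If p = x is real, it commutes with everything and the right-hand side is
e^(xq) e_*(q^bar, u) e^(-xu).  If p = u^bar, then e_*(u^bar, q) is the
conjugate of e_*(q^bar, u), the middle factor is the real number
|e_*(q^bar, u)|^2, and what remains is the exponential series of -|u|^2.

The rearrangement is justified as an iterated sum.  For fixed m only the
finitely many k <= m occur, so the inner series converges to a finite sum
(cvg_hermite_inner); the partial sums of the outer series are then sums of
t k a over the triangles k + a < N, where t k a is the term
(-1)^k/k! p^k (p^a q^a/a!) e_*(q^bar, u) u^k.  Sums over the squares
k, a < N differ from these by at most |e_*(q^bar, u)| times the same
difference for the product of the exponential series of |p||u| and |p||q|,
which tends to 0 because exp (s + t) = exp s * exp t.  Over the squares, the
sum over a can be carried out inside, and the sums over k < N are linear maps
bounded uniformly in N, so the limit in a may be taken first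
(cvg_equibounded). *)

(** * Sums over squares and triangles *)

Lemma sum_square_sub_triangle (V : zmodType) (t : nat -> nat -> V) N :
  \sum_(0 <= k < N) \sum_(0 <= a < N) t k a
    - \sum_(0 <= m < N) \sum_(0 <= k < m.+1) t k (m - k)%N
  = \sum_(0 <= k < N) \sum_(0 <= a < N | (N <= k + a)%N) t k a.
Proof.
have -> : \sum_(0 <= m < N) \sum_(0 <= k < m.+1) t k (m - k)%N =
          \sum_(0 <= k < N) \sum_(0 <= a < N | ~~ (N <= k + a)%N) t k a.
  transitivity (\sum_(0 <= m < N) \sum_(0 <= k < N | (k <= m)%N) t k (m - k)%N).
    rewrite big_nat [RHS]big_nat; apply: eq_bigr => m /= mN.
    by rewrite (big_nat_widen _ _ N) //; apply: eq_bigl => k; rewrite ltnS.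
  rewrite (exchange_big_dep_nat predT) //=.
  rewrite big_nat [RHS]big_nat; apply: eq_bigr => k /= kN.
  transitivity (\sum_(k <= m < N) t k (m - k)%N).
    by rewrite [RHS](big_nat_widenl _ 0).
  rewrite -{1}[k]add0n big_addn.
  under eq_bigr do rewrite addnK.
  rewrite (big_nat_widen _ _ N) ?leq_subr//.
  by apply: eq_bigl => a; rewrite -ltnNge ltn_subRL.
rewrite -sumrB; apply: eq_bigr => k _.
by rewrite (bigID (fun a => (N <= k + a)%N)) /= addrK.
Qed.

(** Both differences run over the same indices, those of the square that lie
outside the triangle, so a termwise bound carries over. *)
Lemma norm_square_sub_triangle (R : numDomainType) (V : normedZmodType R)
    (t : nat -> nat -> V) (r : nat -> nat -> R) N :
  (forall k a, `|t k a| <= r k a) ->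
  `|\sum_(0 <= k < N) \sum_(0 <= a < N) t k a
    - \sum_(0 <= m < N) \sum_(0 <= k < m.+1) t k (m - k)%N|
  <= \sum_(0 <= k < N) \sum_(0 <= a < N) r k a
    - \sum_(0 <= m < N) \sum_(0 <= k < m.+1) r k (m - k)%N.
Proof.
move=> tr; rewrite !sum_square_sub_triangle.
apply: le_trans (ler_norm_sum _ _ _) _; apply: ler_sum => k _.
by apply: le_trans (ler_norm_sum _ _ _) _; apply: ler_sum.
Qed.

Lemma exp_coeffD (R : realType) (s t : R) m :
  exp_coeff (s + t) m =
  \sum_(0 <= k < m.+1) exp_coeff s k * exp_coeff t (m - k)%N.
Proof.
rewrite /exp_coeff /= addrC exprDn mulr_suml big_mkord.
apply: eq_bigr => -[k /=]; rewrite ltnS => km _.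
rewrite -mulr_natl -(bin_fact km) natrM natrM.
have := @pnatr_eq0 R k`!; have := @pnatr_eq0 R (m - k)`!.
have := @pnatr_eq0 R 'C(m, k).
rewrite !gtn_eqF ?fact_gt0 ?bin_gt0// => c0 b0 a0.
by field; rewrite a0 b0 c0.
Qed.

(** By the binomial theorem the triangle sum is a partial sum of the
exponential series at s + t, and the square sum is a product of partial sums;
the functional equation of the exponential equates their limits. *)
Lemma cvg_exp_square_sub_triangle (R : realType) (s t : R) :
  (fun N => \sum_(0 <= k < N) \sum_(0 <= a < N) exp_coeff s k * exp_coeff t a
    - \sum_(0 <= m < N) \sum_(0 <= k < m.+1)
        exp_coeff s k * exp_coeff t (m - k)%N) @ \oo --> (0 : R).
Proof.
have -> : (fun N =>
    \sum_(0 <= k < N) \sum_(0 <= a < N) exp_coeff s k * exp_coeff t a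
    - \sum_(0 <= m < N) \sum_(0 <= k < m.+1)
        exp_coeff s k * exp_coeff t (m - k)%N) =
  (fun N => series (exp_coeff s) N * series (exp_coeff t) N
    - series (exp_coeff (s + t)) N).
  apply/funext => N; congr (_ - _); first by rewrite /series /= big_distrlr.
  by apply: eq_bigr => m _; rewrite exp_coeffD.
rewrite -(subrr (expR (s + t))) {1}expRD.
by apply: cvgB; [apply: cvgM|]; exact: is_cvg_series_exp_coeff.
Qed.

(** * Algebra of the quaternionic norm and conjugation *)

Section QuaternionNormTheory.
Variable R : rcfType.
Implicit Types p q : quaternion R.

Lemma normq_sqr q :
  `|q| ^+ 2 = qre q ^+ 2 + qim_i q ^+ 2 + qim_j q ^+ 2 + qim_k q ^+ 2.
Proof.
by case: q => a b c d; rewrite [X in X ^+ 2]/Num.norm /= sqr_sqrtr ?addr_ge0 ?sqr_ge0.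
Qed.

Lemma normqM p q : `|p * q| = `|p| * `|q|.
Proof.
apply/eqP; rewrite -(@eqrXn2 _ 2)// ?mulr_ge0// exprMn !normq_sqr.
by case: p q => a b c d [a' b' c' d'] /=; apply/eqP; ring.
Qed.

Lemma normqX q n : `|q ^+ n| = `|q| ^+ n.
Proof.
elim: n => [|n IH]; last by rewrite !exprS normqM IH.
apply/eqP; rewrite expr0 -(@eqrXn2 _ 2)// normq_sqr /=.
by apply/eqP; ring.
Qed.

Lemma norm_qconj q : `|qconj q| = `|q|.
Proof.
apply/eqP; rewrite -(@eqrXn2 _ 2)// !normq_sqr.
by case: q => a b c d /=; apply/eqP; ring.
Qed.

Lemma qconjB : {morph @qconj R : p q / p - q}.
Proof. by case=> ? ? ? ? [? ? ? ?]; congr Quaternion; rewrite /=; ring. Qed.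

Lemma qconjD : {morph @qconj R : p q / p + q}.
Proof. by case=> ? ? ? ? [? ? ? ?]; congr Quaternion; rewrite /=; ring. Qed.

Lemma qconj0 : qconj 0 = 0 :> quaternion R.
Proof. by congr Quaternion; rewrite oppr0. Qed.

Lemma qconjZ (x : R) q : qconj (x *: q) = x *: qconj q.
Proof. by case: q => ? ? ? ?; congr Quaternion; rewrite /=; ring. Qed.

Lemma qconjM p q : qconj (p * q) = qconj q * qconj p.
Proof. by case: p q => ? ? ? ? [? ? ? ?]; congr Quaternion; rewrite /=; ring. Qed.

Lemma qconjK : involutive (@qconj R).
Proof. by case=> ? ? ? ?; rewrite /= !opprK. Qed.

Lemma qconjX q n : qconj (q ^+ n) = qconj q ^+ n.
Proof.
elim: n => [|n IH]; first by congr Quaternion; rewrite oppr0.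
by rewrite exprS qconjM IH exprSr.
Qed.

Lemma qconj_mul q : qconj q * q = (`|q| ^+ 2)%:A.
Proof. by rewrite -{2}[q]qconjK mulq_conj norm_qconj. Qed.

End QuaternionNormTheory.

(** * Limits and series of quaternions *)

(** Exchange of limits: linear maps with a common bound send z n - a to 0
uniformly.  With a constant sequence of maps, this is the continuity of a
bounded linear map. *)
Lemma cvg_equibounded (R : realType) (V W : normedModType R)
    (f : nat -> V -> W) (K : R) (z : nat -> V) (a : V) (l : W) :
  (forall n, {morph f n : v w / v - w}) ->
  (forall n v, `|f n v| <= K * `|v|) ->
  z @ \oo --> a -> f ^~ a @ \oo --> l -> (fun n => f n (z n)) @ \oo --> l.
Proof.
move=> fB fK za fal; apply: cvg_sub0 fal; apply: norm_cvg0.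
apply: (@squeeze_cvgr _ _ _ _ (cst 0) (fun n => K * `|z n - a|)).
- by near=> n; rewrite normr_ge0 -[X in `|X|]/(f n (z n) - f n a) -fB fK.
- exact: cvg_cst.
rewrite -[X in _ --> X](mulr0 K); apply: cvgMr.
by rewrite -[X in _ --> X](normr0 V); apply: cvg_norm; apply/subr_cvg0.
Unshelve. all: by end_near. Qed.

Section QuaternionLimits.
Variable R : realType.
Local Notation H := (quaternion R).

Lemma cvg_mulql (a : H) (z : nat -> H) (l : H) :
  z @ \oo --> l -> (fun n => a * z n) @ \oo --> a * l.
Proof.
move=> zl.
apply: (@cvg_equibounded R H H (fun=> *%R a) `|a| _ _ (a * l) _ _ zl).
- by move=> _ v w /=; rewrite mulrBr.
- by move=> _ v; rewrite normqM.
- exact: cvg_cst.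
Qed.

Lemma cvg_mulqr (a : H) (z : nat -> H) (l : H) :
  z @ \oo --> l -> (fun n => z n * a) @ \oo --> l * a.
Proof.
move=> zl.
apply: (@cvg_equibounded R H H (fun=> *%R^~ a) `|a| _ _ (l * a) _ _ zl).
- by move=> _ v w /=; rewrite mulrBl.
- by move=> _ v /=; rewrite normqM mulrC.
- exact: cvg_cst.
Qed.

Lemma cvg_qconj (z : nat -> H) (l : H) :
  z @ \oo --> l -> (fun n => qconj (z n)) @ \oo --> qconj l.
Proof.
move=> zl.
apply: (@cvg_equibounded R H H (fun=> @qconj R) 1 _ _ (qconj l) _ _ zl).
- by move=> _; exact: qconjB.
- by move=> _ v; rewrite norm_qconj mul1r.
- exact: cvg_cst.
Qed.

(** This gives the completeness of the quaternions in the form that is used: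
limits are assembled from those of the four real coordinates. *)
Lemma is_cvg_quaternion (z : nat -> H) :
  cvgn (fun n => qre (z n)) -> cvgn (fun n => qim_i (z n)) ->
  cvgn (fun n => qim_j (z n)) -> cvgn (fun n => qim_k (z n)) -> cvgn z.
Proof.
move=> ca cb cc cd.
have -> : z = (fun n => qre (z n) *: (Quaternion 1 0 0 0 : H)
    + qim_i (z n) *: (Quaternion 0 1 0 0 : H)
    + qim_j (z n) *: (Quaternion 0 0 1 0 : H)
    + qim_k (z n) *: (Quaternion 0 0 0 1 : H)).
  apply/funext => n /=; case: (z n) => a b c d.
  by congr Quaternion; rewrite /=; ring.
by apply: is_cvgD; [apply: is_cvgD; [apply: is_cvgD|]|];
  apply: is_cvgZr_tmp.
Qed.

Lemma is_cvg_seriesq_dominated (z : nat -> H) (r : nat -> R) :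
  (forall n, `|z n| <= r n) -> cvgn (series r) -> cvgn (series z).
Proof.
move=> zr cr.
have coord (g : H -> R) : g 0 = 0 -> {morph g : v w / v + w} ->
    (forall v, g v ^+ 2 <= `|v| ^+ 2) -> cvgn (g \o series z).
  move=> g0 gD g2.
  have -> : g \o series z = series (g \o z).
    by apply/funext => n; rewrite /series /= (big_morph g gD g0).
  have gle n : `|g (z n)| <= r n.
    apply: le_trans (zr n); rewrite -ler_sqr ?nnegrE// real_normK ?num_real//.
  apply: normed_cvg; apply: series_le_cvg cr => n //=.
  exact: le_trans (gle n).
by apply: is_cvg_quaternion; apply: coord => //;
  do ?[by case=> ? ? ? ? [? ? ? ?]] => -[a b c d];
  rewrite normq_sqr /=; nra.
Qed.

Definition exp_star_term (p q : H) n : H := n`!%:R^-1 *: (p ^+ n * q ^+ n).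

Lemma norm_exp_star_term p q n :
  `|exp_star_term p q n| = exp_coeff (`|p| * `|q|) n.
Proof.
by rewrite normrZ normqM !normqX -exprMn /exp_coeff /= mulrC ger0_norm//.
Qed.

Lemma cvg_qexp_star (p q : H) :
  series (exp_star_term p q) @ \oo --> qexp_star p q.
Proof.
apply: (@is_cvg_seriesq_dominated _ (exp_coeff (`|p| * `|q|))).
  by move=> n; rewrite norm_exp_star_term.
exact: is_cvg_series_exp_coeff.
Qed.

Lemma qconj_qexp_star (p q : H) :
  qconj (qexp_star p q) = qexp_star (qconj q) (qconj p).
Proof.
apply/esym/cvg_lim; first exact: norm_hausdorff.
suff <- : (fun n => qconj (series (exp_star_term p q) n)) =
    series (exp_star_term (qconj q) (qconj p)).
  by apply: cvg_qconj; exact: cvg_qexp_star.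
apply/funext => n; rewrite /series /= (big_morph _ (@qconjD R) (qconj0 R)).
by apply: eq_bigr => k _; rewrite qconjZ qconjM !qconjX.
Qed.

End QuaternionLimits.

(** * The double series of the Hermite polynomials *)

Section HermiteGenerating.
Variable R : realType.
Local Notation H := (quaternion R).

Lemma cvg_series_delay (f : nat -> H) (l : H) k :
  series f @ \oo --> l ->
  series (fun n => if (k <= n)%N then f (n - k)%N else 0) @ \oo --> l.
Proof.
move=> fl; rewrite -(cvg_shiftn k).
rewrite [X in X @ _](_ : _ = series f) //.
apply/funext => n; rewrite /series /= (big_cat_nat _ (n := k))//= ?leq_addl//.
rewrite big_nat big1 ?add0r => [|i /andP[_ ik]]; last by rewrite leqNgt ik.
rewrite -{1}[k]add0n big_addn addnK.
by apply: eq_bigr => i _; rewrite leq_addl addnK.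
Qed.

Variables p q u : H.

(** The operator whose sum over k replaces multiplication by e^(-pu) when p is
not real: p stays on the left of z and u on its right. *)
Definition sandwich k (z : H) : H :=
  ((-1) ^+ k / k`!%:R) *: (p ^+ k * z * u ^+ k).

Lemma sandwichB k : {morph sandwich k : v w / v - w}.
Proof. by move=> v w; rewrite /sandwich mulrBr mulrBl scalerBr. Qed.

Lemma norm_sandwich k z :
  `|sandwich k z| = exp_coeff (`|p| * `|u|) k * `|z|.
Proof.
rewrite normrZ !normqM !normqX normrM normrX normrN1 expr1n mul1r.
by rewrite /exp_coeff /= exprMn ger0_norm ?invr_ge0//; ring.
Qed.

(** From p^m = p^k p^(m-k), u^n = u^(n-k) u^k and
k! C(m, k) C(n, k)/(m! n!) = 1/(k! (m-k)! (n-k)!).  The sum is taken up to m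
rather than min(m, n) so that its length does not depend on n, the index of
the inner series. *)
Lemma hermite_termE m n :
  (m`!%:R^-1 *: p ^+ m) * hermiteQ m n q * (n`!%:R^-1 *: u ^+ n) =
  \sum_(0 <= k < m.+1) if (k <= n)%N then
    sandwich k (exp_star_term p q (m - k) * exp_star_term (qconj q) u (n - k))
  else 0.
Proof.
rewrite -big_mkcond /=.
have -> : \sum_(0 <= k < m.+1 | (k <= n)%N)
    sandwich k (exp_star_term p q (m - k) * exp_star_term (qconj q) u (n - k))
  = \sum_(k < (minn m n).+1)
    sandwich k (exp_star_term p q (m - k) * exp_star_term (qconj q) u (n - k)).
  rewrite -(big_mkord predT (fun k => sandwich k (exp_star_term p q (m - k)
    * exp_star_term (qconj q) u (n - k)))).
  rewrite (big_nat_widen _ _ m.+1) ?ltnS ?geq_minl//.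
  rewrite [LHS]big_nat_cond [RHS]big_nat_cond; apply: eq_bigl => k /=.
  by rewrite !ltnS leq_min; case: (k <= m)%N.
rewrite /hermiteQ mulr_sumr mulr_suml; apply: eq_bigr => -[k /=].
rewrite ltnS leq_min => /andP[km kn] _.
rewrite /sandwich /exp_star_term.
rewrite -!(@scalerAl R H, @scalerAr R H) !scalerA.
congr (_ *: _).
  have nz j : (j`!)%:R != 0 :> R by rewrite pnatr_eq0 gtn_eqF ?fact_gt0.
  have bin j : (k <= j)%N -> 'C(j, k)%:R = j`!%:R / (k`!%:R * (j - k)`!%:R) :> R.
    move=> kj; rewrite -(bin_fact kj) !natrM mulfK// mulf_neq0.
  by rewrite !bin//; field; rewrite !nz.
rewrite -{1}(subnKC km) exprD -[in u ^+ n](subnK kn) [u ^+ (_ + _)]exprD.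
by rewrite !mulrA.
Qed.

Let E := qexp_star (qconj q) u.

(** Each of the m + 1 summands, as a function of n, is the series of
e_*(q^bar, u) delayed by k steps and multiplied by constants. *)
Lemma cvg_hermite_inner m :
  series (fun n =>
    (m`!%:R^-1 *: p ^+ m) * hermiteQ m n q * (n`!%:R^-1 *: u ^+ n)) @ \oo -->
  \sum_(0 <= k < m.+1) sandwich k (exp_star_term p q (m - k) * E).
Proof.
have -> : series (fun n =>
    (m`!%:R^-1 *: p ^+ m) * hermiteQ m n q * (n`!%:R^-1 *: u ^+ n)) =
  (fun N => \sum_(0 <= k < m.+1) series (fun n => if (k <= n)%N then
    sandwich k (exp_star_term p q (m - k) * exp_star_term (qconj q) u (n - k))
  else 0) N).
  apply/funext => N; rewrite /series /= exchange_big /=.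
  by apply: eq_bigr => n _; exact: hermite_termE.
apply: cvg_big => [|k _]; first exact: add_continuous.
apply: (@cvg_series_delay (fun n => sandwich k
  (exp_star_term p q (m - k) * exp_star_term (qconj q) u n))).
have -> : series (fun n => sandwich k
    (exp_star_term p q (m - k) * exp_star_term (qconj q) u n)) =
  (fun N => sandwich k
    (exp_star_term p q (m - k) * series (exp_star_term (qconj q) u) N)).
  apply/funext => N; rewrite /series /= /sandwich.
  by rewrite mulr_sumr mulr_sumr mulr_suml scaler_sumr.
by apply: cvgZl_tmp; apply: cvg_mulqr; do 2 apply: cvg_mulql; exact: cvg_qexp_star.
Qed.

(** On squares the inner sums are partial sums of e_*(p, q), independent of k;
the partial sums over k of the sandwich operators are bounded by
exp(|p||u|). *)
Lemma cvg_sandwich_qexp_star (l : H) :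
  series (fun k => sandwich k (qexp_star p q * E)) @ \oo --> l ->
  (fun N => \sum_(0 <= k < N) \sum_(0 <= a < N)
    sandwich k (exp_star_term p q a * E)) @ \oo --> l.
Proof.
move=> hl.
have -> : (fun N => \sum_(0 <= k < N) \sum_(0 <= a < N)
    sandwich k (exp_star_term p q a * E)) =
  (fun N => \sum_(0 <= k < N) sandwich k (series (exp_star_term p q) N * E)).
  apply/funext => N; apply: eq_bigr => k _.
  by rewrite /series /= /sandwich mulr_suml mulr_sumr mulr_suml scaler_sumr.
refine (@cvg_equibounded R H H
  (fun N z => \sum_(0 <= k < N) sandwich k z) (expR (`|p| * `|u|))
  _ _ l _ _ (cvg_mulqr (a := E) (cvg_qexp_star (p := p) (q := q))) hl).
- by move=> N v w; rewrite -sumrB; apply: eq_bigr => k _; exact: sandwichB.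
move=> N v; apply: le_trans (ler_norm_sum _ _ _) _.
under eq_bigr do rewrite norm_sandwich.
rewrite -mulr_suml ler_wpM2r//.
apply: (nondecreasing_cvgn_le (u_ := series (exp_coeff (`|p| * `|u|)))).
  apply/nondecreasing_seqP => n; rewrite /series /= big_nat_recr//=.
  by rewrite lerDl exp_coeff_ge0// mulr_ge0.
exact: is_cvg_series_exp_coeff.
Qed.

(** The identity behind both formulas.  It reduces the iterated sum to a simple
series, whose convergence is immediate in each of the two applications. *)
Lemma hermite_iterated_sum (l : H) :
  series (fun k => sandwich k (qexp_star p q * E)) @ \oo --> l ->
  iterated_sum_to (fun m n =>
    (m`!%:R^-1 *: p ^+ m) * hermiteQ m n q * (n`!%:R^-1 *: u ^+ n)) l.
Proof.
move=> hl; split.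
  by move=> m; apply: cvgP; exact: cvg_hermite_inner.
have -> : (fun m => limn (series (fun n =>
    (m`!%:R^-1 *: p ^+ m) * hermiteQ m n q * (n`!%:R^-1 *: u ^+ n)))) =
  (fun m => \sum_(0 <= k < m.+1) sandwich k (exp_star_term p q (m - k) * E)).
  apply/funext => m; apply: cvg_lim; first exact: norm_hausdorff.
  exact: cvg_hermite_inner.
(* The partial sums of the outer series are sums over triangles. *)
apply: cvg_sub0 (cvg_sandwich_qexp_star hl).
apply: norm_cvg0.
pose c k := exp_coeff (`|p| * `|u|) k; pose d a := exp_coeff (`|p| * `|q|) a.
apply: (@squeeze_cvgr _ _ _ _ (cst 0) (fun N => `|E| *
  (\sum_(0 <= k < N) \sum_(0 <= a < N) c k * d a
    - \sum_(0 <= m < N) \sum_(0 <= k < m.+1) c k * d (m - k)%N))).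
- near=> N; rewrite normr_ge0 /=.
  rewrite -[X in `|X|]/(\sum_(0 <= m < N) \sum_(0 <= k < m.+1)
    sandwich k (exp_star_term p q (m - k) * E) - \sum_(0 <= k < N)
    \sum_(0 <= a < N) sandwich k (exp_star_term p q a * E)) distrC.
  rewrite mulrBr !mulr_sumr.
  under [X in _ <= X - _]eq_bigr do rewrite mulr_sumr.
  under [X in _ <= _ - X]eq_bigr do rewrite mulr_sumr.
  apply: (norm_square_sub_triangle (r := fun k a => `|E| * (c k * d a))) => k a.
  rewrite norm_sandwich normqM norm_exp_star_term.
  by rewrite /c /d mulrA mulrC.
- exact: cvg_cst.
rewrite -[X in _ --> X](mulr0 `|E|); apply: cvgMr.
exact: cvg_exp_square_sub_triangle.
Unshelve. all: by end_near. Qed.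

End HermiteGenerating.

Theorem theorem5p4 (R : realType) (x : R) (u q : quaternion R) :
  iterated_sum_to
    (fun m n => (x ^+ m / m`!%:R) *: (hermiteQ m n q * (n`!%:R^-1 *: u ^+ n)))
    (qexp (x *: q) * qexp_star (qconj q) u * qexp (- (x *: u)))
  /\
  iterated_sum_to
    (fun m n => (m`!%:R^-1 *: qconj u ^+ m) * hermiteQ m n q
                * (n`!%:R^-1 *: u ^+ n))
    (expR (- `|u| ^+ 2) * `|qexp_star (qconj q) u| ^+ 2)%:A.
Proof.
set E := qexp_star (qconj q) u; split.
- have star v : qexp_star x%:A v = qexp (x *: v).
    congr (limn (series _)); apply/funext => n.
    by rewrite !exprZn expr1n -scalerAl mul1r.
  have -> : (fun m n => (x ^+ m / m`!%:R) *:
      (hermiteQ m n q * (n`!%:R^-1 *: u ^+ n))) =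
    (fun m n => (m`!%:R^-1 *: x%:A ^+ m) * hermiteQ m n q
                * (n`!%:R^-1 *: u ^+ n)).
    apply/funext => m; apply/funext => n.
    by rewrite exprZn expr1n scalerA -mulrA -scalerAl mul1r mulrC.
  apply: hermite_iterated_sum; rewrite star -/E.
  have -> : series (fun k => sandwich x%:A u k (qexp (x *: q) * E)) =
    (fun N => qexp (x *: q) * E *
      series (exp_star_term x%:A (- u)) N).
    apply/funext => N; rewrite /series /= mulr_sumr; apply: eq_bigr => k _.
    rewrite /sandwich /exp_star_term
      exprZn expr1n -!(@scalerAl R (quaternion R), @scalerAr R (quaternion R)).
    rewrite !mul1r -(scaleN1r u) exprZn -(@scalerAr R (quaternion R)) !scalerA.
    by congr (_ *: _); ring.
  by rewrite -scalerN -(star (- u)); apply: cvg_mulql; exact: cvg_qexp_star.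
apply: hermite_iterated_sum.
rewrite -[in X in series X]/E.
have -> : qexp_star (qconj u) q * E = (`|E| ^+ 2)%:A.
  by rewrite -[q in qexp_star _ q]qconjK -qconj_qexp_star qconj_mul.
have -> : series (fun k => sandwich (qconj u) u k (`|E| ^+ 2)%:A) =
  (fun N => (series (exp_coeff (- `|u| ^+ 2)) N * `|E| ^+ 2)%:A).
  apply/funext => N; rewrite /series /= mulr_suml scaler_suml.
  apply: eq_bigr => k _; rewrite /sandwich /exp_coeff /=.
  (* The powers pair off from the inside, each pair being the real |u|^2. *)
  have powu : qconj u ^+ k * u ^+ k = (`|u| ^+ 2 ^+ k)%:A.
    elim: k => [|k IH]; first by rewrite !expr0 mulr1 scale1r.
    rewrite exprSr exprS mulrA -(mulrA _ (qconj u)) qconj_mul.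
    by rewrite -scalerAr mulr1 -scalerAl IH scalerA -exprS.
  rewrite -scalerAr mulr1 -scalerAl powu !scalerA; congr (_ *: _).
  by rewrite [(- (_ ^+ 2)) ^+ k]exprNn; ring.
apply: cvgZr_tmp; apply: cvgMl; exact: is_cvg_series_exp_coeff.
Qed.
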